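(* Let $n>1$ and let $S$ be an ideal aperiodic orientable sequence of order $n$ of length $\ell$. Write $D^{-1}(S)=\{T,\bar T\}$ where $T$ is the element beginning with $n$ zeros, and let $U=\bar{T}^R$ (the complement of $T$ written in reverse order). If $n$ is even, let $V$ be the sequence of length $2\ell-n+2$ consisting of the $\ell+1$ bits of $T$ followed by the last $\ell-n+1$ bits of $U$ (i.e. $U$ with its first $n$ bits removed). If $n$ is odd, let $V$ be the sequence of length $2\ell-n+3$ consisting of the $\ell+1$ bits of $T$ followed by the last $\ell-n+2$ bits of $U$ (i.e. $U$ with its first $n-1$ bits removed). Then in both cases $V$ is an ideal aperiodic orientable sequence of order $n+1$.
   Context: For a finite binary sequence $S=(s_0,\dots,s_{\ell-1})$, $\mathbf{s}_n(i)=(s_i,\dots,s_{i+n-1})$ for $0\le i\le\ell-n$; the reverse of a tuple or finite sequence $(u_0,\dots,u_{k-1})$ is $(u_{k-1},\dots,u_0)$, written with superscript $R$. $S$ is an aperiodic orientable sequence of order $n$ if the $2\ell-2n+2$ tuples $\mathbf{s}_n(i)$ and their reverses ($0\le i\le\ell-n$) are all distinct. It is ideal ($n>1$) if its first $n-1$ bits are all $0$ and its last $n-1$ bits are all $1$. The complement $\bar T$ swaps $0$ and $1$ in every position. Lempel map: $D(t_0,\dots,t_\ell)=(t_0\oplus t_1,\dots,t_{\ell-1}\oplus t_\ell)$ ($\oplus$ = addition mod 2); $D^{-1}(S)$ is the set of binary sequences of length $\ell+1$ with $D(T)=S$ (it consists of a sequence and its complement). *)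

(* Defs.v *)
(* Bits are booleans (0 = false, 1 = true), so [addb] is
   addition modulo 2; the reverse of a tuple or sequence is [rev]. *)
From mathcomp Require Import all_boot.

Set Implicit Arguments.
Unset Strict Implicit.
Unset Printing Implicit Defensive.

Definition window (n : nat) (S : seq bool) (i : nat) : seq bool :=
  take n (drop i S).

(* i ranges over 0 <= i <= size S - n; the bound is written so that the list is
   empty, rather than containing a truncated window, when size S < n. *)
Definition windows (n : nat) (S : seq bool) : seq (seq bool) :=
  [seq window n S i | i <- iota 0 ((size S).+1 - n)].

Definition aperiodic_orientable (n : nat) (S : seq bool) : Prop :=
  uniq (windows n S ++ [seq rev w | w <- windows n S]).

(* Intended for n > 1.  Both equations force n.-1 <= size S. *)
Definition ideal (n : nat) (S : seq bool) : Prop :=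
  take n.-1 S = nseq n.-1 false /\
  drop (size S - n.-1) S = nseq n.-1 true.

Definition complement (T : seq bool) : seq bool := [seq ~~ b | b <- T].

Definition lempel (T : seq bool) : seq bool :=
  if T is t0 :: T' then pairmap addb t0 T' else [::].

Definition lempel_preimage (S : seq bool) : pred (seq bool) :=
  [pred T | (size T == (size S).+1) && (lempel T == S)].

Lemma lempel_preimageP (S T : seq bool) : T \in lempel_preimage S ->
  forall T', T' \in lempel_preimage S <-> T' = T \/ T' = complement T.
Proof.
rewrite inE; case: T => // t T /= /andP[_ /eqP <-{S}] [|t' T'].
  by split=> // -[].
rewrite inE /= size_pairmap.
have scan b R : scanl addb b (pairmap addb b R) = R.
  by apply: pairmapK => x y; rewrite addbA addbb.
have compl b R : pairmap addb (~~ b) (complement R) = pairmap addb b R.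
  by elim: R b => //= c R IH b; rewrite IH addNb addbN negbK.
split.
  case/andP=> _ /eqP E.
  have [tt|neq] := eqVneq t' t; [left | right].
    by rewrite tt in E *; rewrite -[T'](scan t) E scan.
  have tt : t' = ~~ t by case: t t' neq {E} => -[].
  by rewrite tt in E *; rewrite -[T'](scan (~~ t)) E -(compl t) scan.
by case=> -[-> ->]; rewrite ?size_map ?compl !eqxx.
Qed.

Lemma lempel_preimage_zeros (n : nat) (S : seq bool) : 0 < n -> ideal n S ->
  exists2 T, T \in lempel_preimage S & take n T = nseq n false.
Proof.
case: n => // n _ [/= takeS _]; exists (false :: scanl addb false S).
  rewrite inE /= size_scanl eqxx /=; apply/eqP.
  by apply: scanlK => x y; rewrite addbA addbb.
rewrite /=; congr (_ :: _); elim: n S takeS => [|n IH] [|s S] //=.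
by case=> -> /(IH _) ->.
Qed.

(* Main.v *)
Require Import Defs.
From mathcomp Require Import all_boot.
From mathcomp Require Import zify.

Set Implicit Arguments.
Unset Strict Implicit.
Unset Printing Implicit Defensive.

(** Write [T = X ++ Y] with [size Y = n].  As [S] ends with [n.-1] ones, [Y]
    alternates, so [T] and [U] overlap in [Y] when [n] is even and in [behead Y]
    when [n] is odd.  Hence the windows of [V] are those of [T], those of [U],
    and, for odd [n], one alternating window at the junction.  Since
    [lempel U = rev S], the windows and reversed windows of [V] are the words
    [w], [rev w], [complement w], [complement (rev w)] for [w] a window of [T].
    Complementary words have the same image under [lempel], so distinctness
    reduces to that of the images, which are the windows of [S] and their
    reverses.  The alternating window has image [1^n], a palindrome, so this is
    not a window of [S]. *)

Lemma complementK : involutive complement.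
Proof. exact: mapK negbK. Qed.

Lemma complement_neq (T : seq bool) : T != [::] -> complement T != T.
Proof. by case: T => // x T _; rewrite eqseq_cons; case: x. Qed.

Lemma complement_rev (T : seq bool) : complement (rev T) = rev (complement T).
Proof. exact: map_rev. Qed.

Lemma lempel_cons2 (x y : bool) (T : seq bool) :
  lempel [:: x, y & T] = (x (+) y) :: lempel (y :: T).
Proof. by []. Qed.

Lemma size_lempel (T : seq bool) : size (lempel T) = (size T).-1.
Proof. by case: T => // x T; rewrite /= size_pairmap. Qed.

Lemma lempel_complement (T : seq bool) : lempel (complement T) = lempel T.
Proof.
case: T => //= x T; elim: T x => //= y T IH x.
by rewrite IH addNb addbN negbK.
Qed.

Lemma lempel_rcons (x y : bool) (T : seq bool) :
  lempel (rcons (x :: T) y) = rcons (lempel (x :: T)) (last x T (+) y).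
Proof. by rewrite /= -cats1 pairmap_cat /= cats1. Qed.

Lemma lempel_rev (T : seq bool) : lempel (rev T) = rev (lempel T).
Proof.
elim: T => // x [//|y T] IH; rewrite lempel_cons2 rev_cons [RHS]rev_cons -IH.
rewrite rev_cons; case: (rev T) => [|z R]; first by rewrite /= addbC.
by rewrite rcons_cons lempel_rcons last_rcons addbC.
Qed.

Lemma lempel_drop (i : nat) (T : seq bool) :
  lempel (drop i T) = drop i (lempel T).
Proof.
elim: i T => [|i IH] [|x T]; rewrite ?drop0 //=.
by rewrite IH; case: T => //= y T; case: i {IH}.
Qed.

Lemma lempel_take (n : nat) (T : seq bool) :
  lempel (take n.+1 T) = take n (lempel T).
Proof. by elim: n T => [|n IH] [|x [|y T]] //=; have /= -> := IH (y :: T). Qed.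

Lemma last_alternating (x : bool) (T : seq bool) :
  lempel (x :: T) = nseq (size T) true -> last x T = x (+) odd (size T).
Proof.
elim: T x => [|y T IH] x /=; first by rewrite addbF.
by case=> xy /IH ->; case: x y xy => -[] //= _; case: (odd _).
Qed.

(** [complement (rev T)] has the same image as [T], so it is [T] or [complement T]. The latter would
    make [T] a palindrome, but an alternating word of even positive length has distinct end bits. *)
Lemma complement_rev_alternating (T : seq bool) :
    lempel T = nseq (size T).-1 true -> ~~ odd (size T) ->
  complement (rev T) = T.
Proof.
case: T => // x T altT evenT; have lastT := last_alternating altT.
have pre : x :: T \in lempel_preimage (lempel (x :: T)).
  by rewrite inE size_lempel !eqxx.
have [|//|] := (lempel_preimageP pre (complement (rev (x :: T)))).1.
  rewrite inE lempel_complement lempel_rev altT rev_nseq.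
  by rewrite size_map size_rev size_nseq !eqxx.
move=> /(can_inj complementK) /(congr1 (head x)).
case/lastP: T lastT evenT {altT pre} => // T y.
rewrite last_rcons rev_cons rev_rcons /= size_rcons => -> /negPn ->.
by case: x.
Qed.

Lemma windows_short (n : nat) (S : seq bool) : size S < n -> windows n S = [::].
Proof. by rewrite /windows -subn_eq0 => /eqP ->. Qed.

Lemma windows_cons (n : nat) (x : bool) (S : seq bool) : n <= (size S).+1 ->
  windows n (x :: S) = take n (x :: S) :: windows n S.
Proof.
move=> le_n; rewrite /windows [size (x :: S)]/= subSn //= /window drop0.
by rewrite (iotaDl 1 0) -map_comp.
Qed.

(** A window of length [n.+1] starting in [X] ends within [X ++ Y]; every other one lies in
    [Y ++ Z]. *)
Lemma windows_cat (n : nat) (X Y Z : seq bool) : size Y = n ->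
  windows n.+1 (X ++ Y ++ Z) = windows n.+1 (X ++ Y) ++ windows n.+1 (Y ++ Z).
Proof.
move=> sizeY; elim: X => [|x X IH] /=.
  by rewrite (@windows_short _ Y) ?sizeY.
rewrite !windows_cons ?size_cat; try lia.
rewrite IH /= catA takel_cat // size_cat; lia.
Qed.

Lemma windows_size (n : nat) (S : seq bool) : size S = n ->
  windows n S = [:: S].
Proof.
by move=> <-; rewrite /windows subSnn /= /window drop0 take_size.
Qed.

Lemma windows_complement (n : nat) (S : seq bool) :
  windows n (complement S) = [seq complement w | w <- windows n S].
Proof.
rewrite /windows size_map -map_comp; apply: eq_map => i /=.
by rewrite /window /complement map_take map_drop.
Qed.

Lemma windows_rev (n : nat) (S : seq bool) :
  windows n (rev S) = rev [seq rev w | w <- windows n S].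
Proof.
apply: (@eq_from_nth _ [::]) => [|i].
  by rewrite size_rev !size_map !size_iota size_rev.
rewrite size_map size_iota size_rev => lt_i.
rewrite nth_rev ?size_map ?size_iota // -map_comp.
rewrite !(nth_map 0) ?size_iota ?size_rev //; last by lia.
rewrite !nth_iota ?size_rev //=; last by lia.
rewrite /window !add0n drop_rev take_rev size_takel; last by lia.
congr rev; rewrite take_drop; congr (drop _ (take _ _)); lia.
Qed.

Lemma lempel_windows (n : nat) (T : seq bool) : 0 < n ->
  [seq lempel w | w <- windows n.+1 T] = windows n (lempel T).
Proof.
move=> n_gt0; rewrite /windows size_lempel -map_comp.
have -> : (size T).+1 - n.+1 = (size T).-1.+1 - n by lia.
by apply: eq_map => i /=; rewrite /window lempel_take lempel_drop.
Qed.

Lemma windows_lempel_rev (n : nat) (T : seq bool) (W := windows n.+1 T) :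
    0 < n ->
  [seq lempel w | w <- W ++ [seq rev w | w <- W]]
    = windows n (lempel T) ++ [seq rev w | w <- windows n (lempel T)].
Proof.
move=> n_gt0; rewrite map_cat -lempel_windows // -!map_comp.
by congr cat; apply: eq_map => w; apply: lempel_rev.
Qed.

(** [lempel] is injective on [Q] and identifies complements, so [complement w] in [Q] would equal
    [w], impossible for a nonempty word. *)
Lemma uniq_cat_complement (Q : seq (seq bool)) :
    [::] \notin Q -> uniq [seq lempel w | w <- Q] ->
  uniq (Q ++ [seq complement w | w <- Q]).
Proof.
move=> Qnil uniqDQ; have uniqQ := map_uniq uniqDQ.
rewrite cat_uniq uniqQ map_inj_uniq ?uniqQ ?andbT /=; last first.
  exact: can_inj complementK.
apply/hasPn => _ /mapP[w Qw ->]; apply/negP => Qcw.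
have injD : {in Q &, injective lempel}.
  move=> _ _ /(nthP [::])[i lt_i <-] /(nthP [::])[j lt_j <-] eqD.
  apply/eqP; rewrite (nth_uniq _ lt_i lt_j uniqQ).
  by rewrite -(nth_uniq [::] _ _ uniqDQ) ?size_map // !(nth_map [::]) // eqD.
have /eqP := injD _ _ Qcw Qw (lempel_complement w).
by apply/negP/complement_neq; apply: contraNneq Qnil => <-.
Qed.

Lemma nil_notin_windows (n : nat) (T : seq bool) :
  [::] \notin windows n.+1 T ++ [seq rev w | w <- windows n.+1 T].
Proof.
have Wnil : [::] \notin windows n.+1 T.
  apply/mapP => -[i]; rewrite mem_iota => /andP[_ lt_i] /(congr1 size).
  rewrite /window size_take_min size_drop /=; lia.
rewrite mem_cat (negPf Wnil); apply: contra Wnil => /mapP[w Ww].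
by move/(congr1 rev); rewrite revK => nilw; rewrite -nilw in Ww.
Qed.

(* [E] is the list of windows at the junction: empty or one alternating word. *)
Lemma aperiodic_orientable_glue (n : nat) (S T V : seq bool)
    (E : seq (seq bool)) : 0 < n ->
    aperiodic_orientable n S -> lempel T = S ->
    windows n.+1 V
      = windows n.+1 T ++ E ++ windows n.+1 (rev (complement T)) ->
    [::] \notin E -> [seq rev w | w <- E] = [seq complement w | w <- E] ->
    uniq [seq lempel w | w <- E] ->
    ~~ has [in windows n S ++ [seq rev w | w <- windows n S]]
         [seq lempel w | w <- E] ->
  aperiodic_orientable n.+1 V.
Proof.
rewrite /aperiodic_orientable => n_gt0 aosS DT WV Enil revE uniqE disjE.
pose W := windows n.+1 T; pose Q := W ++ [seq rev w | w <- W].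
(* The windows of [rev (complement T)] are the words [complement (rev w)]. Their order is irrelevant
   to [uniq], so only multiplicities are compared. *)
have /perm_uniq -> : perm_eq
    (windows n.+1 V ++ [seq rev w | w <- windows n.+1 V])
    ((Q ++ E) ++ [seq complement w | w <- Q ++ E]).
  rewrite WV windows_rev windows_complement -/W /Q; move: (W) => R.
  rewrite !map_cat map_rev revE -!map_comp.
  rewrite (@eq_map _ _ (rev \o (rev \o complement)) complement); last first.
    by move=> w /=; rewrite revK.
  rewrite (@eq_map _ _ (complement \o rev) (rev \o complement)); last first.
    by move=> w /=; rewrite complement_rev.
  apply/permP => a; rewrite !count_cat !count_rev.
  have AC i j k p q r : i + (j + k) + (p + (q + r)) = i + p + j + (r + k + q).
    by lia.
  exact: AC.
apply: uniq_cat_complement.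
  by rewrite mem_cat negb_or nil_notin_windows.
by rewrite map_cat windows_lempel_rev // DT cat_uniq aosS disjE uniqE.
Qed.

(** A palindromic window would occur in both halves of the list. *)
Lemma ones_notin_windows (n : nat) (S : seq bool) :
    aperiodic_orientable n S ->
  nseq n true \notin windows n S ++ [seq rev w | w <- windows n S].
Proof.
rewrite /aperiodic_orientable cat_uniq => /and3P[_ /hasPn disj _].
have revW : nseq n true \in [seq rev w | w <- windows n S]
    = (nseq n true \in windows n S).
  by rewrite -{1}(rev_nseq n) mem_map //; apply: can_inj revK.
rewrite mem_cat revW orbb; apply/negP => Wones.
by have := disj (nseq n true); rewrite revW /= Wones => /(_ isT).
Qed.

(** The leading zeros of [T] become trailing ones in [rev (complement T)]. *)
Lemma ideal_glue (n : nat) (T X Z : seq bool) :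
    take n T = nseq n false -> n <= size T ->
    T ++ Z = X ++ rev (complement T) ->
  ideal n.+1 (T ++ Z).
Proof.
move=> T0 le_n eqV; split; rewrite /= ?takel_cat // eqV.
rewrite -(cat_take_drop n T) T0 /complement map_cat map_nseq rev_cat.
by rewrite rev_nseq catA drop_size_cat // [in RHS]size_cat size_nseq addnK.
Qed.

Theorem theorem7 (n : nat) (S T : seq bool)
  (n_gt1 : 1 < n)
  (aosS : aperiodic_orientable n S) (idealS : ideal n S)
  (DT : T \in lempel_preimage S) (T_zeros : take n T = nseq n false) :
  let l := size S in
  let U := rev (complement T) in
  (~~ odd n ->
     let V := T ++ drop n U in
     [/\ size V = 2 * l - n + 2, aperiodic_orientable n.+1 V & ideal n.+1 V])
  /\
  (odd n ->
     let V := T ++ drop n.-1 U in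
     [/\ size V = 2 * l - n + 3, aperiodic_orientable n.+1 V & ideal n.+1 V]).
Proof.
move=> l U; have [/eqP sizeT /eqP lemT] := andP DT.
have n_gt0 : 0 < n by lia.
(* The equation for the leading zeros of [S] forces [n.-1 <= size S]. *)
have le_n : n <= size T.
  have := congr1 size idealS.1.
  by rewrite size_take_min size_nseq sizeT; lia.
pose X := take (size T - n) T; pose Y := drop (size T - n) T.
have TXY : T = X ++ Y by rewrite cat_take_drop.
have sizeY : size Y = n by rewrite size_drop; lia.
(* The offsets agree: [size T - n = size S - n.-1]. *)
have altY : lempel Y = nseq n.-1 true.
  rewrite /Y lempel_drop lemT -idealS.2; congr drop; lia.
clearbody X Y.
have UYX : U = complement (rev Y) ++ complement (rev X).
  by rewrite /U TXY /complement map_cat rev_cat !map_rev.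
have sizeU : size U = l.+1 by rewrite size_rev size_map.
split=> parn V.
  (* Since [Y] has even length, [U] starts with [Y], exactly the [n] bits dropped. *)
  have revY : complement (rev Y) = Y.
    by apply: complement_rev_alternating; rewrite sizeY.
  have eqV : V = X ++ U.
    by rewrite /V UYX revY drop_size_cat // TXY catA.
  split; last exact: ideal_glue T_zeros le_n eqV.
    rewrite size_cat size_drop sizeU sizeT -/l; lia.
  apply: (@aperiodic_orientable_glue n S T V [::]) => //.
  by rewrite -/U eqV UYX revY TXY windows_cat.
(* For odd [n] only the tail has even length, so the overlap is one bit shorter. *)
case: Y => [|a Y] in TXY sizeY altY UYX; first by rewrite -sizeY in n_gt0.
have sizeY' : size Y = n.-1 by rewrite -sizeY.
have revY : complement (rev Y) = Y.
  apply: complement_rev_alternating; last by rewrite sizeY'; lia.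
  have := congr1 behead altY; rewrite -sizeY' -drop1 -lempel_drop /= drop0 => ->.
  by case: (Y).
(* The junction window: the last [n] bits of [T], then the first bit of [U] past the overlap. *)
pose e := rcons (a :: Y) (~~ a).
have lastY : last a Y = a.
  rewrite last_alternating ?sizeY' // (_ : odd n.-1 = false) ?addbF //; lia.
have {}UYX : U = rcons Y (~~ a) ++ complement (rev X).
  by rewrite UYX rev_cons /complement map_rcons -/(complement _) revY.
have eqV : V = rcons X a ++ U.
  by rewrite /V UYX -[rcons Y _]cats1 -!catA drop_size_cat // TXY -cats1 -!catA.
have lem_e : lempel e = nseq n true.
  rewrite lempel_rcons altY lastY addbN addbb.
  by rewrite -[n in RHS](prednK n_gt0) -[n.-1.+1]addn1 nseqD cats1.
split; last exact: ideal_glue T_zeros le_n eqV.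
  rewrite size_cat size_drop sizeU sizeT -/l; lia.
apply: (@aperiodic_orientable_glue n S T V [:: e]) => //.
(* Cutting at [a :: Y] isolates the windows of [T]; a second cut at [rcons Y (~~ a)] separates [e]
   from those of [U]. *)
- have -> : V = X ++ (a :: Y) ++ ~~ a :: complement (rev X).
    by rewrite eqV UYX -!cats1 -!catA.
  rewrite windows_cat // -TXY; congr cat.
  rewrite -/U UYX -(@windows_size n.+1 e) ?size_rcons ?sizeY //.
  rewrite -(@windows_cat n [:: a]) ?size_rcons ?sizeY'; last by lia.
  by rewrite cat_rcons.
(* The end bits of [e] are complementary, and [revY] settles the middle. *)
- rewrite /= /e rev_rcons rev_cons /complement map_rcons /= negbK.
  by rewrite -[in RHS]revY -/(complement _) complementK.
by rewrite -[map lempel _]/[:: lempel e] lem_e /= orbF ones_notin_windows.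
Qed.
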